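(* Suppose $n\le m$. If $\mu=\mathcal{N}(m_0,\Sigma_0)$ is a Gaussian measure on $\mathbb{R}^m$ with $\Sigma_0$ non-singular and $\nu=\mathcal{N}(m_1,\Sigma_1)$ is a Gaussian measure on $\mathbb{R}^n$, then $$LGW_2^2(\mu,\nu)\ \le\ GW_2^2(\mu,\nu)\ \le\ GGW_2^2(\mu,\nu).$$
   Context: For probability measures $\mu$ on $\mathbb{R}^m$, $\nu$ on $\mathbb{R}^n$, let $\Pi(\mu,\nu)$ be the set of probability measures on $\mathbb{R}^m\times\mathbb{R}^n$ with marginals $\mu,\nu$, and for $\pi\in\Pi(\mu,\nu)$ let $$J(\pi)=\int\int\left(\|x-x'\|_{\mathbb{R}^m}^2-\|y-y'\|_{\mathbb{R}^n}^2\right)^2d\pi(x,y)\,d\pi(x',y').$$ Then $GW_2^2(\mu,\nu)=\inf_{\pi\in\Pi(\mu,\nu)}J(\pi)$ and $GGW_2^2(\mu,\nu)=\inf_{\pi\in\Pi(\mu,\nu)\cap\mathcal{N}_{m+n}}J(\pi)$, where $\mathcal{N}_{m+n}$ is the set of (possibly degenerate) Gaussian measures on $\mathbb{R}^{m+n}$. With diagonalizations $\Sigma_0=P_0D_0P_0^T$, $\Sigma_1=P_1D_1P_1^T$ ($P_0,P_1$ orthogonal, $D_0,D_1$ diagonal with eigenvalues in non-increasing order) and $n\le m$, $$LGW_2^2(\mu,\nu)=4\left(\mathrm{tr}(D_0)-\mathrm{tr}(D_1)\right)^2+4\left(\|D_0\|_{\mathcal{F}}-\|D_1\|_{\mathcal{F}}\right)^2+4\|D_0^{(n)}-D_1\|_{\mathcal{F}}^2+4\left(\|D_0\|_{\mathcal{F}}^2-\|D_0^{(n)}\|_{\mathcal{F}}^2\right),$$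 where $\|\cdot\|_{\mathcal{F}}$ is the Frobenius norm and $D_0^{(n)}$ is the submatrix of the first $n$ rows and $n$ columns of $D_0$. *)

(* Defs.v *)
From HB Require Import structures.
From mathcomp Require Import all_boot all_order all_algebra.
From mathcomp Require Import all_classical all_reals all_analysis.
Import Order.TTheory GRing.Theory Num.Theory.
Import numFieldNormedType.Exports.

Set Implicit Arguments.
Unset Strict Implicit.
Unset Printing Implicit Defensive.

Local Open Scope classical_set_scope.
Local Open Scope ring_scope.

(* R^n is [n.-tuple R] with the library's product sigma-algebra, which is the
   Borel sigma-algebra of R^n. The library's norm on ['rV[R]_n] is the sup
   norm, so the Euclidean distance is defined here. *)
Section Euclidean.
Variable R : realType.

Definition edist (n : nat) (x y : n.-tuple R) : R :=
  Num.sqrt (\sum_(i < n) (tnth x i - tnth y i) ^+ 2).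

Definition linform (n : nat) (u : 'cV[R]_n) (x : n.-tuple R) : R :=
  \sum_(i < n) u i ord0 * tnth x i.

Definition frobenius (p q : nat) (A : 'M[R]_(p, q)) : R :=
  Num.sqrt (\sum_(i < p) \sum_(j < q) A i j ^+ 2).

End Euclidean.

Section Gaussian.
Variable R : realType.

(* The law N(a, v) on the line, of mean a and variance v >= 0. The second
   argument of [normal_prob] is the standard deviation, and its value at 0 is
   not the Dirac mass, whence the case distinction. *)
Definition gaussian1 (a v : R) : set (measurableTypeR R) -> \bar R :=
  if v == 0 then dirac a else normal_prob a (Num.sqrt v).

Definition psd (n : nat) (S : 'M[R]_n) : Prop :=
  S^T = S /\ forall u : 'cV[R]_n, 0 <= (u^T *m S *m u) ord0 ord0.

(* P = N(a, S), possibly degenerate: the image of P under every linear form u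
   is the one-dimensional Gaussian of mean u^T a and variance u^T S u. *)
Definition is_gaussian (n : nat) (a : 'cV[R]_n) (S : 'M[R]_n)
    (P : probability (n.-tuple (measurableTypeR R)) R) : Prop :=
  psd S /\
  forall (u : 'cV[R]_n) (A : set (measurableTypeR R)), measurable A ->
    pushforward P (linform u : _ -> measurableTypeR R) A =
    gaussian1 ((u^T *m a) ord0 ord0) ((u^T *m S *m u) ord0 ord0) A.

End Gaussian.

Section GromovWasserstein.
Variables (R : realType) (m n : nat).
Local Notation Rm := (m.-tuple (measurableTypeR R)).
Local Notation Rn := (n.-tuple (measurableTypeR R)).

Definition couplings (mu : probability Rm R) (nu : probability Rn R) :
    set (probability (Rm * Rn)%type R) :=
  [set pi | (forall A : set Rm, measurable A -> pushforward pi fst A = mu A) /\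
            (forall B : set Rn, measurable B -> pushforward pi snd B = nu B)].

Definition catRmn (p : Rm * Rn) : (m + n).-tuple (measurableTypeR R) :=
  [tuple of p.1 ++ p.2].

(* Gaussian measures on R^m x R^n identified with R^(m+n). *)
Definition gaussians : set (probability (Rm * Rn)%type R) :=
  [set pi | exists (a : 'cV[R]_(m + n)) (S : 'M[R]_(m + n))
      (P : probability ((m + n).-tuple (measurableTypeR R)) R),
      is_gaussian a S P /\
      forall A, measurable A -> pushforward pi catRmn A = P A].

Definition GWcost (pi : probability (Rm * Rn)%type R) : \bar R :=
  (\int[pi]_q \int[pi]_p
     ((edist p.1 q.1 ^+ 2 - edist p.2 q.2 ^+ 2) ^+ 2)%:E)%E.

Definition GW2 (mu : probability Rm R) (nu : probability Rn R) : \bar R :=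
  ereal_inf [set GWcost pi | pi in couplings mu nu].

Definition GGW2 (mu : probability Rm R) (nu : probability Rn R) : \bar R :=
  ereal_inf [set GWcost pi | pi in couplings mu nu `&` gaussians].

End GromovWasserstein.

Section LowerBound.
Variable R : realType.

(* S = P D P^T with P orthogonal and D diagonal with non-increasing entries. *)
Definition is_diagonalization (n : nat) (S P D : 'M[R]_n) : Prop :=
  [/\ P^T *m P = 1%:M, is_diag_mx D,
      forall i j : 'I_n, (i <= j)%N -> D j j <= D i i &
      S = P *m D *m P^T].

Definition leading_submx (m n : nat) (nm : (n <= m)%N) (D : 'M[R]_m) : 'M[R]_n :=
  mxsub (widen_ord nm) (widen_ord nm) D.

Definition LGW2 (m n : nat) (nm : (n <= m)%N)
    (D0 : 'M[R]_m) (D1 : 'M[R]_n) : R :=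
  4 * (\tr D0 - \tr D1) ^+ 2
  + 4 * (frobenius D0 - frobenius D1) ^+ 2
  + 4 * frobenius (leading_submx nm D0 - D1) ^+ 2
  + 4 * (frobenius D0 ^+ 2 - frobenius (leading_submx nm D0) ^+ 2).

End LowerBound.

(* Main.v *)
Require Import Defs.
From HB Require Import structures.
From mathcomp Require Import all_boot all_order all_algebra.
From mathcomp Require Import all_classical all_reals all_analysis.
From mathcomp Require Import measurable_realfun ring lra.
Import Order.TTheory GRing.Theory Num.Theory.
Import numFieldNormedType.Exports.
Set Implicit Arguments.
Unset Strict Implicit.
Unset Printing Implicit Defensive.
Local Open Scope classical_set_scope.
Local Open Scope ring_scope.

(** Fix a coupling pi of mu and nu and write |.| for the Euclidean norms. Take
coordinates x_i of R^m along the eigenvectors of S0, centred at m0, and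
coordinates y_j of R^n along the eigenvectors of S1, centred at m1. Put
A = sum_i x_i^2 and B = sum_j y_j^2. Under pi the x_i are uncorrelated with
variances the diagonal entries of D0, and likewise the y_j with D1; only the
cross-covariances K_ij = E[x_i y_j] and the covariance of A and B depend on the
coupling.

The integrand |x-x'|^2 - |y-y'|^2 expands into
A + A' - B - B' - 2 <x,x'> + 2 <y,y'>, a finite sum of products g_i(p) h_i(q)
of square-integrable functions. The iterated integral of the square of such a
sum is the double sum of <g_i,g_j><h_i,h_j>, where <.,.> is the inner product
of L^2(pi) ([iterated_integral_sqr_sum]). Since the coordinates are centred,
this gives ([GWcost_coordinates])
  J(pi) = 2 E[(A-B)^2] + 2 (tr D0 - tr D1)^2
          + 4 (|D0|^2 + |D1|^2 - 2 sum_ij K_ij^2).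
Two estimates turn this into LGW2:
- Var(A) = 2 |D0|^2 and Var(B) = 2 |D1|^2, so Cauchy-Schwarz gives
  Cov(A,B) <= 2 |D0| |D1| ([covariance_dot_le]);
- sum_ij K_ij^2 <= sum_(j < n) D0_jj D1_jj ([sum_sqr_cross_covariance_le]).
  Bessel's inequality, used in both directions, says that the matrix
  K_ij^2 / (D0_ii D1_jj) has row and column sums at most 1; a linear form with
  sorted weights D0_ii D1_jj is then largest at the diagonal matrix, which is
  proved with an explicit solution of the dual of the assignment problem
  ([assignment_dual]).

The hypothesis on mu and nu describes the laws of linear forms only, and this is
enough: E[u^4] and E[u^2] for all linear forms u give, by polarization,
E[u^2 v^2] = E[u^2] E[v^2] + 2 E[uv]^2 ([dot_cform_sqr]), and no independence of
coordinates has to be extracted. The moments on the line are computed from the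
Gauss integral by integration by parts ([half_gauss_moment_rec]).

The second inequality compares infima over a set and over one of its
subsets. *)

(** * Even moments of Gaussian laws on the line *)

Section GaussianMoments.
Context {R : realType}.
Local Notation leb := (@lebesgue_measure R).

Lemma cvg_exprn_gauss_fun (k : nat) :
  (n%:R ^+ k * gauss_fun (n%:R : R)) @[n --> \oo] --> (0 : R).
Proof.
have h : (k.+1)`!%:R * (n%:R : R)^-1 @[n --> \oo] --> (0 : R).
  rewrite -(mulr0 (k.+1)`!%:R); apply: cvgMl_tmp.
  apply/gtr0_cvgV0; last exact: cvgr_idn.
  by near=> n; rewrite ltr0n; near: n; exact: nbhs_infty_gt.
apply: (squeeze_cvgr _ (cvg_cst 0) h).
near=> n.
have n0 : (0 < n%:R :> R) by rewrite ltr0n; near: n; exact: nbhs_infty_gt.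
rewrite mulr_ge0 ?exprn_ge0 ?expR_ge0 ?ler0n//=.
rewrite /gauss_fun expRN ler_pdivrMr ?expR_gt0//.
have n1 : (1 <= n%:R :> R) by rewrite ler1n -(ltr0n R).
have := @expR_ge1Dxn R (n%:R ^+ 2) k (exprn_ge0 _ (ltW n0)).
rewrite mulrAC ler_pdivlMr// => h1.
have /(le_trans _) : (k.+1)`!%:R * ((n%:R ^+ 2) ^+ k.+1 / (k.+1)`!%:R) <=
    (k.+1)`!%:R * expR (n%:R ^+ 2) :> R.
  by rewrite ler_wpM2l// (le_trans _ h1)// lerDr.
apply; rewrite mulrCA divff ?pnatr_eq0 -?lt0n ?fact_gt0// mulr1 -exprM -exprSr.
by rewrite ler_weXn2l// mul2n -addnn leq_addr.
Unshelve. all: by end_near. Qed.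

Lemma is_derive_gauss_fun (x : R) :
  is_derive x 1 (fun y : R => - (gauss_fun y / 2)) (x * gauss_fun x).
Proof.
rewrite /gauss_fun.
have h1 : is_derive x 1 (fun y : R => - y ^+ 2) (- (2 * x)).
  apply: is_derive_eq; rewrite /GRing.scale/=; lra.
have h := @is_derive1_comp _ expR _ x _ _ (is_derive_expR _) h1.
rewrite (_ : (fun y => _) = - (2^-1 \*: (expR \o (fun y : R => - y ^+ 2)))); last first.
  by apply/funext => y /=; rewrite mulrC.
apply: is_derive_eq.
rewrite /GRing.scale/=; lra.
Qed.

Lemma continuous_exprn_gauss_fun k : continuous (fun x : R => x ^+ k * gauss_fun x).
Proof.
by move=> x; apply: cvgM; [exact: exprn_continuous|exact: continuous_gauss_fun].
Qed.

Lemma derivable_oo_LRcontinuousT (f : R -> R) a b :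
  (forall x, derivable f x 1) -> derivable_oo_LRcontinuous f a b.
Proof.
move=> df; have cf : continuous f.
  by move=> x; exact/differentiable_continuous/derivable1_diffP/df.
split => //.
- by apply: cvg_at_right_filter; exact: cf.
- by apply: cvg_at_left_filter; exact: cf.
Qed.

(** Integration by parts of [x ^+ (2 * k).+1] against [x * gauss_fun x], whose
primitive is [- gauss_fun x / 2]; it is done on [0, n], where every function is
integrable, and the limit is taken afterwards, so that the integrability of the
higher moment comes out of the identity. *)
Lemma half_gauss_moment_rec (k : nat) :
  (\int[leb]_(x in `[0%R, +oo[) (x ^+ (2 * k.+1) * gauss_fun x)%:E =
   ((2 * k).+1%:R / 2)%:E *
     \int[leb]_(x in `[0%R, +oo[) (x ^+ (2 * k) * gauss_fun x)%:E)%E.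
Proof.
have ge0 j (x : R) : 0 <= x ^+ (2 * j) * gauss_fun x.
  by rewrite mulr_ge0 ?gauss_fun_ge0// exprM exprn_ge0// sqr_ge0.
have mf j : measurable_fun setT (fun x : R => x ^+ (2 * j) * gauss_fun x).
  apply: continuous_measurable_fun; exact: continuous_exprn_gauss_fun.
have L := @ge0_cvgn_integral R leb _ (ge0 k.+1) (mf k.+1).
have L0 := @ge0_cvgn_integral R leb _ (ge0 k) (mf k).
suff L1 : (\int[leb]_(x in `[0%R, n%:R]) (x ^+ (2 * k.+1) * gauss_fun x)%:E)%E
    @[n --> \oo] --> (((2 * k).+1%:R / 2)%:E *
     \int[leb]_(x in `[0%R, +oo[) (x ^+ (2 * k) * gauss_fun x)%:E)%E.
  exact: (cvg_unique _ L L1).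
have B : ((- 2^-1 * (n%:R ^+ (2 * k).+1 * gauss_fun (n%:R : R)))%:E)%E
    @[n --> \oo] --> (0 : \bar R)%E.
  apply: cvg_EFin; first exact: nearW.
  have := cvgM (cvg_cst (- 2^-1 : R)) (cvg_exprn_gauss_fun (2 * k).+1).
  by rewrite mulr0; exact.
have {}L0 := cvgeZl (isT : ((2 * k).+1%:R / 2)%:E \is a fin_num) L0.
rewrite -[X in _ --> X]add0e.
apply: cvg_trans (cvgeD _ B L0); last by rewrite fin_num_adde_defr.
apply: near_eq_cvg; near=> n.
have n0 : (0 < n%:R :> R) by rewrite ltr0n; near: n; exact: nbhs_infty_gt.
have dX (j : nat) (x : R) : is_derive x 1 (fun y : R => y ^+ j.+1) (j.+1%:R * x ^+ j).
  have h := @is_deriveX R _ id j.+1 x 1 1 (is_derive_id _ _).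
  by rewrite exprfctE /GRing.scale/= mulr1 in h; exact: h.
transitivity (\int[leb]_(x in `[0%R, n%:R])
    (x ^+ (2 * k).+1 * (x * gauss_fun x))%:E)%E; last first.
  by apply: eq_integral => x _; rewrite mulrA -exprSr mulnS.
rewrite (@integration_by_parts R (fun x => x ^+ (2 * k).+1)
  (fun x => - (gauss_fun x / 2)) (fun x => (2 * k).+1%:R * x ^+ (2 * k))
  (fun x => x * gauss_fun x))//.
- rewrite /= expr0n/= mul0r subr0 -integralZl//=; last first.
    apply: continuous_compact_integrable; first exact: segment_compact.
    exact/continuous_subspaceT/continuous_exprn_gauss_fun.
  congr (_ + _)%E; first by congr EFin; rewrite /=; lra.
  rewrite -mulN1e -integralZl//=; last first.
    apply: continuous_compact_integrable; first exact: segment_compact.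
    apply: continuous_subspaceT => x; apply: cvgM.
      by apply: cvgM; [exact: cvg_cst|exact: exprn_continuous].
    apply: cvgN; apply: cvgM; [exact: continuous_gauss_fun|exact: cvg_cst].
  by apply: eq_integral => x _; rewrite -!EFinM; congr EFin; lra.
- apply: continuous_subspaceT => x; apply: cvgM; [exact: cvg_cst|exact: exprn_continuous].
- by apply: derivable_oo_LRcontinuousT => x; have [] := dX (2 * k)%N x.
- by move=> x _; rewrite derive1E; have [] := dX (2 * k)%N x.
- exact/continuous_subspaceT/(@continuous_exprn_gauss_fun 1).
- by apply: derivable_oo_LRcontinuousT => x; have [] := is_derive_gauss_fun x.
- by move=> x _; rewrite derive1E; have [] := is_derive_gauss_fun x.
Unshelve. all: by end_near. Qed.

Lemma gauss_moment (k : nat) :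
  (\int[leb]_x (x ^+ (2 * k) * gauss_fun x)%:E =
   (\prod_(i < k) ((2 * i).+1%:R / 2) * Num.sqrt pi)%:E)%E.
Proof.
rewrite ge0_symfun_integralT; first last.
- by move=> x /=; rewrite /gauss_fun !exprM !sqrrN.
- exact: continuous_exprn_gauss_fun.
- by move=> x; rewrite mulr_ge0 ?gauss_fun_ge0// exprM exprn_ge0// sqr_ge0.
rewrite -set_itvcy; transitivity
  (2%:E * (\prod_(i < k) ((2 * i).+1%:R / 2) * (Num.sqrt pi / 2) : R)%:E)%E; last first.
  by rewrite -EFinM; congr EFin; lra.
congr (_ * _)%E; elim: k => [|k IH].
  rewrite big_ord0 mul1r -integral0y_gauss.
  by apply: eq_integral => x _; rewrite expr0 mul1r.
by rewrite half_gauss_moment_rec IH big_ord_recr/= -EFinM; congr EFin; lra.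
Qed.

(** The density of [normal_prob] agrees almost everywhere with its
Radon-Nikodym derivative, because both have the same integral on every
measurable set. *)
Lemma integral_normal_prob (a s : R) (f : R -> R) : (forall x, 0 <= f x) ->
  measurable_fun setT f ->
  (\int[normal_prob a s]_x (f x)%:E = \int[leb]_x (f x * normal_pdf a s x)%:E)%E.
Proof.
move=> f0 mf.
have dom := normal_prob_dominates a s.
rewrite -(Radon_Nikodym_SigmaFinite.change_of_variables dom)//=; last exact/measurable_EFinP.
under [RHS]eq_integral do rewrite EFinM.
have iRN := Radon_Nikodym_SigmaFinite.f_integrable dom.
apply: ae_eq_integral => //.
- apply: emeasurable_funM; first exact/measurable_EFinP.
  exact: measurable_int iRN.
- apply: emeasurable_funM; first exact/measurable_EFinP.
  by apply/measurable_EFinP; exact: measurable_normal_pdf.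
- apply: ae_eqe_mul2l; apply: integral_ae_eq => //.
  + by apply/measurable_EFinP; exact: measurable_normal_pdf.
  + by move=> E _ mE; rewrite -Radon_Nikodym_SigmaFinite.f_integral.
Qed.

(** The substitution [x = a + Num.sqrt (2 * v) * z] reduces every Gaussian law to
[gauss_fun]. The right-hand side does not mention [a] and also covers the Dirac
mass [v = 0]; both facts are used below, the first one to obtain that centred
linear forms have mean zero. *)
Lemma integral_centered_gaussian1 (Q : {measure set (measurableTypeR R) -> \bar R})
    (a v : R) (phi : R -> R) : 0 <= v ->
  (forall A : set (measurableTypeR R), measurable A -> Q A = gaussian1 a v A) ->
  (forall x, 0 <= phi x) -> continuous phi ->
  (\int[Q]_x (phi (x - a))%:E = ((Num.sqrt pi)^-1)%:E *
    \int[leb]_z (phi (Num.sqrt (2 * v) * z) * gauss_fun z)%:E)%E.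
Proof.
move=> v0 QE phi0 cphi.
have sp0 : 0 < Num.sqrt pi :> R by rewrite sqrtr_gt0 pi_gt0.
have mphi : measurable_fun setT phi by apply: continuous_measurable_fun.
have mphia : measurable_fun setT (fun x : R => phi (x - a)).
  by apply: (measurableT_comp mphi); exact: measurable_funB.
move: QE; rewrite /gaussian1; case: eqP => [->|/eqP vN0] QE.
  transitivity (\int[dirac (a : measurableTypeR R)]_x
      (phi (x - a))%:E)%E.
    by apply: eq_measure_integral => A mA _; exact: QE.
  rewrite integral_dirac//; last exact/measurable_EFinP.
  rewrite diracT mul1e subrr mulr0 sqrtr0.
  under eq_integral do rewrite mul0r EFinM.
  rewrite integralZl//=; last exact: integrableT_gauss.
  rewrite integralT_gauss -!EFinM; congr EFin.
  by rewrite mulrCA mulVf ?mulr1// gt_eqF.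
transitivity (\int[normal_prob a (Num.sqrt v)]_x
    (phi (x - a))%:E)%E.
  by apply: eq_measure_integral => A mA _; exact: QE.
have {}v0 : 0 < v by rewrite lt_neqAle eq_sym vN0.
have sv0 : Num.sqrt v != 0 by rewrite gt_eqF// sqrtr_gt0.
rewrite integral_normal_prob//.
pose c := Num.sqrt (2 * v).
have c0 : 0 < c by rewrite sqrtr_gt0 mulr_gt0.
pose F := fun x : R^o => (x - a) / c.
have F'E : F^`()%classic = cst c^-1.
  apply/funext => x; rewrite /F derive1E deriveM// deriveD// derive_cst scaler0.
  by rewrite add0r derive_id derive_cst addr0 scaler1.
rewrite [in RHS](@increasing_ge0_integration_by_substitutionT _ F); first last.
- by move=> x; rewrite mulr_ge0 ?gauss_fun_ge0.
- move=> x; apply: cvgM; last exact: continuous_gauss_fun.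
  have cx : c * z @[z --> x] --> c * x by apply: cvgMl_tmp; exact: cvg_id.
  exact: (cvg_comp _ _ cx (cphi _)).
- apply/gt0_cvgMly; last exact: cvg_addrr.
  by rewrite invr_gt0.
- apply/gt0_cvgMlNy; last exact: cvg_addrr_Ny.
  by rewrite invr_gt0.
- by [].
- by rewrite F'E; exact: is_cvg_cst.
- by rewrite F'E; exact: is_cvg_cst.
- by rewrite F'E => ?; exact: cvg_cst.
- by move=> x y xy; rewrite /F ltr_pM2r ?ltr_leB ?gt_eqF// invr_gt0.
rewrite -ge0_integralZl//=; last 2 first.
- apply/measurable_EFinP; rewrite F'E; apply: measurable_funM => //.
  apply: (@measurableT_comp _ _ _ _ _ _ (fun z => phi (c * z) * gauss_fun z)).
    apply: measurable_funM; last exact: measurable_gauss_fun.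
    by apply: (measurableT_comp mphi); exact: measurable_funM.
  by apply: measurable_funM => //; exact: measurable_funB.
- move=> x _; rewrite lee_fin F'E; apply: mulr_ge0; last by rewrite /= invr_ge0 ltW.
  by apply: mulr_ge0; [exact: phi0|exact: gauss_fun_ge0].
apply: eq_integral => x _; rewrite F'E -EFinM; congr EFin.
rewrite normal_pdfE// /normal_peak /normal_fun /gauss_fun /F !fctE -/c.
have -> : c * ((x - a) / c) = x - a by rewrite mulrCA divff ?gt_eqF// mulr1.
have -> : (Num.sqrt v ^+ 2 * pi *+ 2) = (2 * v) * pi.
  by rewrite sqr_sqrtr ?ltW//; lra.
rewrite sqrtrM ?mulr_ge0 ?ltW// -/c.
have -> : Num.sqrt v ^+ 2 *+ 2 = c ^+ 2.
  by rewrite !sqr_sqrtr ?mulr_ge0 ?ltW//; lra.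
have -> : - (x - a) ^+ 2 / c ^+ 2 = - ((x - a) / c) ^+ 2.
  by rewrite exprMn exprVn mulNr.
by rewrite invfM; ring.
Qed.

End GaussianMoments.

(** * The inner product of square-integrable functions *)

Section SquareIntegrable.
Context d (T : measurableType d) (R : realType) (pi : probability T R).
Local Notation L2 := (Lfun pi 2%:E).

Lemma Lfun2_sqr_integrable (f : T -> R) : measurable_fun setT f ->
  pi.-integrable setT (fun x => (f x ^+ 2)%:E) -> f \in L2.
Proof.
move=> mf /integrableP[_ ifoo]; rewrite inE; apply/andP; split; rewrite inE//=.
rewrite /finite_norm unlock /Lnorm poweR_lty//.
apply: le_lt_trans ifoo; apply: ge0_le_integral => //=.
- apply: measurableT_comp => //; apply: (measurableT_comp (measurable_powR _)).
  exact: measurableT_comp.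
- by apply/measurable_EFinP; apply: measurableT_comp => //; exact: measurable_funX.
- by move=> x _; rewrite lee_fin powR_mulrn// normrX.
Qed.

Lemma Lfun2_scale c (f : T -> R) : f \in L2 -> (fun x => c * f x) \in L2.
Proof.
move=> f2; rewrite (_ : (fun x => _) = c \o* f); last first.
  by apply/funext => x /=; rewrite mulrC.
by apply: Lfun_scale => //; rewrite ler1n.
Qed.

Lemma Lfun2_add (f g : T -> R) : f \in L2 -> g \in L2 ->
  (fun x => f x + g x) \in L2.
Proof.
move=> f2 g2; have p1 : (1 <= 2%:E :> \bar R)%E by rewrite lee_fin ler1n.
exact: (Lfun_addr_closed pi p1).2.
Qed.

Lemma Lfun2_sum (I : finType) (c : I -> R) (g : I -> T -> R) :
  (forall i, g i \in L2) -> (fun x => \sum_i c i * g i x) \in L2.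
Proof.
move=> g2; rewrite unlock /=; elim: (index_enum I) => [|i s IH] /=.
  exact: Lfun_cst.
by apply: Lfun2_add => //; exact: Lfun2_scale.
Qed.

Definition dot (f g : T -> R) : R := \int[pi]_x (f x * g x).

Lemma dotC f g : dot f g = dot g f.
Proof. by apply: eq_Rintegral => x _; rewrite mulrC. Qed.

Lemma Lfun2_mul_integrable (f g : T -> R) : f \in L2 -> g \in L2 ->
  pi.-integrable setT (fun x => (f x * g x)%:E).
Proof. by move=> f2 g2; apply/Lfun1_integrable; exact: Lfun2_mul_Lfun1. Qed.

Lemma dotDl f g h : f \in L2 -> g \in L2 -> h \in L2 ->
  dot (fun x => f x + g x) h = dot f h + dot g h.
Proof.
move=> f2 g2 h2; rewrite /dot -RintegralD//; try exact: Lfun2_mul_integrable.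
by apply: eq_Rintegral => x _; rewrite mulrDl.
Qed.

Lemma dotZl c f g : f \in L2 -> g \in L2 ->
  dot (fun x => c * f x) g = c * dot f g.
Proof.
move=> f2 g2; rewrite /dot -RintegralZl//; last exact: Lfun2_mul_integrable.
by apply: eq_Rintegral => x _; rewrite mulrA.
Qed.

Lemma dot_suml (I : finType) (c : I -> R) (g : I -> T -> R) h :
  (forall i, g i \in L2) -> h \in L2 ->
  dot (fun x => \sum_i c i * g i x) h = \sum_i c i * dot (g i) h.
Proof.
move=> g2 h2; rewrite [in RHS]unlock/= [X in dot X h](_ : _ = fun x =>
  reducebig 0 (index_enum I) (fun i => BigBody i +%R true (c i * g i x))); last first.
  by apply/funext => x; rewrite unlock.
have L s : (fun x => reducebig 0 s (fun i => BigBody i +%R true (c i * g i x))) \in L2.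
  elim: s => [|i s IH] /=; first exact: Lfun_cst.
  by apply: Lfun2_add => //; exact: Lfun2_scale.
elim: (index_enum I) => [|i s IH] /=.
  by rewrite /dot; under eq_Rintegral do rewrite mul0r; rewrite Rintegral_cst// mul0r.
by rewrite dotDl// ?dotZl ?IH//; exact: Lfun2_scale.
Qed.

Lemma dot_sumlr (I J : finType) (c : I -> R) (e : J -> R)
    (g : I -> T -> R) (h : J -> T -> R) :
  (forall i, g i \in L2) -> (forall j, h j \in L2) ->
  dot (fun x => \sum_i c i * g i x) (fun x => \sum_j e j * h j x) =
  \sum_i \sum_j c i * e j * dot (g i) (h j).
Proof.
move=> g2 h2; rewrite dot_suml//; last exact: Lfun2_sum.
apply: eq_bigr => i _; rewrite dotC dot_suml// mulr_sumr.
by apply: eq_bigr => j _; rewrite mulrA (dotC (h j)).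
Qed.

Lemma dot_ge0 f : 0 <= dot f f.
Proof. by apply: Rintegral_ge0 => x _; rewrite -expr2 sqr_ge0. Qed.

Lemma integral_dot (f g : T -> R) : f \in L2 -> g \in L2 ->
  (\int[pi]_x (f x * g x)%:E = (dot f g)%:E)%E.
Proof.
move=> f2 g2; rewrite /dot /Rintegral fineK//.
by apply: integrable_fin_num => //; exact: Lfun2_mul_integrable.
Qed.

Lemma dot_lincomb2 s t f g : f \in L2 -> g \in L2 ->
  dot (fun x => s * f x + t * g x) (fun x => s * f x + t * g x) =
  s ^+ 2 * dot f f + 2 * s * t * dot f g + t ^+ 2 * dot g g.
Proof.
move=> f2 g2; have sf := Lfun2_scale s f2; have tg := Lfun2_scale t g2.
have L := Lfun2_add sf tg.
rewrite dotDl// !dotZl// !(dotC _ (fun x => _ + _)) !dotDl// !dotZl// (dotC g f).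
ring.
Qed.

(** The quadratic form [(s, t) |-> dot (s f + t g) (s f + t g)] is nonnegative;
when [dot g g = 0] its values at [s = 1] stay nonnegative only if
[dot f g = 0]. *)
Lemma cauchy_schwarz_dot f g : f \in L2 -> g \in L2 ->
  dot f g <= Num.sqrt (dot f f) * Num.sqrt (dot g g).
Proof.
move=> f2 g2; have H s t : 0 <= s ^+ 2 * dot f f + 2 * s * t * dot f g + t ^+ 2 * dot g g.
  by rewrite -dot_lincomb2//; exact: dot_ge0.
have := dot_ge0 f; have := dot_ge0 g.
move: (dot f f) (dot f g) (dot g g) H => F c G H G0 F0.
have key : c ^+ 2 <= F * G.
  have [G0'|G0'] := eqVneq G 0.
    have [->|c0] := eqVneq c 0; first by rewrite expr0n mulr_ge0.
    (* at this point the form takes the value [-1] *)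
    have := H 1 (- (F + 1) / (2 * c)); rewrite G0' mulr0 addr0 expr1n mul1r mulr1.
    have -> : 2 * (- (F + 1) / (2 * c)) * c = - (F + 1) by field.
    lra.
  have {}G0 : 0 < G by rewrite lt_neqAle eq_sym G0'.
  have := H G (- c).
  have -> : G ^+ 2 * F + 2 * G * - c * c + (- c) ^+ 2 * G = G * (F * G - c ^+ 2) by ring.
  by rewrite pmulr_rge0// subr_ge0.
rewrite -sqrtrM//; apply: le_trans (ler_norm _) _.
by rewrite -sqrtr_sqr ler_wsqrtr.
Qed.

(** For fixed [q] the inner integral is a quadratic form in the [h i q] whose
coefficients are the Gram matrix of the [g i], so each of the two integrals is an
inner product in one variable and no product measure is involved. *)
Lemma iterated_integral_sqr_sum (I : finType) (g h : I -> T -> R) :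
  (forall i, g i \in L2) -> (forall i, h i \in L2) ->
  (\int[pi]_q \int[pi]_p ((\sum_i g i p * h i q) ^+ 2)%:E =
   (\sum_i \sum_j dot (g i) (g j) * dot (h i) (h j))%:E)%E.
Proof.
move=> g2 h2.
have inner q : (\int[pi]_p ((\sum_i g i p * h i q) ^+ 2)%:E =
    \sum_i \sum_j (dot (g i) (g j))%:E * (h i q * h j q)%:E)%E.
  under eq_integral => p _.
    rewrite (_ : \sum_i g i p * h i q = \sum_i h i q * g i p); last first.
      by apply: eq_bigr => i _; rewrite mulrC.
    over.
  rewrite integral_dot; try exact: Lfun2_sum.
  rewrite dot_sumlr// -sumEFin; apply: eq_bigr => i _.
  by rewrite -sumEFin; apply: eq_bigr => j _; rewrite -EFinM mulrC.
under eq_integral do rewrite inner.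
have ih i j : pi.-integrable setT (fun q => (dot (g i) (g j))%:E * (h i q * h j q)%:E)%E.
  by apply: integrableZl => //; exact: Lfun2_mul_integrable.
rewrite integral_sum//; last by move=> i; apply: integrable_sum.
rewrite -sumEFin; apply: eq_bigr => i _.
rewrite integral_sum// -sumEFin; apply: eq_bigr => j _.
by rewrite integralZl//; [rewrite integral_dot|exact: Lfun2_mul_integrable].
Qed.

Local Notation one := (cst (1 : R) : T -> R).

Lemma Lfun2_one : one \in L2. Proof. exact: Lfun_cst. Qed.

Lemma dot_one : dot one one = 1.
Proof.
rewrite /dot /= mul1r Rintegral_cst// [X in fine X](_ : _ = 1%E) ?mul1r//.
exact: probability_setT.
Qed.

(** Cauchy-Schwarz for [f] and [g] minus their means. *)
Lemma covariance_dot_le f g : f \in L2 -> g \in L2 ->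
  dot f g - dot f one * dot g one <=
  Num.sqrt (dot f f - dot f one ^+ 2) * Num.sqrt (dot g g - dot g one ^+ 2).
Proof.
move=> f2 g2; have i2 := Lfun2_one.
have center2 h c : h \in L2 -> (fun x => 1 * h x + c * one x) \in L2.
  by move=> h2; apply: Lfun2_add; exact: Lfun2_scale.
have := cauchy_schwarz_dot (center2 _ (- dot f one) f2) (center2 _ (- dot g one) g2).
rewrite !dot_lincomb2// dot_one.
have -> : dot (fun x => 1 * f x + - dot f one * one x)
    (fun x => 1 * g x + - dot g one * one x) = dot f g - dot f one * dot g one.
  rewrite dotDl ?dotZl//; try exact: Lfun2_scale; try exact: center2.
  rewrite !(dotC _ (fun x => _ + _)) !dotDl ?dotZl//; try exact: Lfun2_scale.
  by rewrite dot_one (dotC one f) (dotC g f); ring.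
have E h : 1 ^+ 2 * dot h h + 2 * 1 * - dot h one * dot h one + (- dot h one) ^+ 2 * 1
    = dot h h - dot h one ^+ 2 by ring.
by rewrite !E.
Qed.

(** With signs [e k] this is the Gromov-Wasserstein cost in centred coordinates.
Each square expands as [z k p ^+ 2 + z k q ^+ 2 - 2 * z k p * z k q], so the sum
over [k] is [W p + W q] plus one product for each [k]; the cross terms between
[W] or [1] and the coordinates vanish because the coordinates have mean zero. *)
Lemma iterated_integral_quadratic (K : finType) (e : K -> R) (z : K -> T -> R) :
  (forall k, z k \in L2) -> (forall k, (fun p => z k p ^+ 2) \in L2) ->
  (forall k, dot (z k) one = 0) ->
  let W := fun p => \sum_k e k * z k p ^+ 2 in
  (\int[pi]_q \int[pi]_p ((\sum_k e k * (z k p - z k q) ^+ 2) ^+ 2)%:E =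
   (2 * dot W W + 2 * dot W one ^+ 2 +
    4 * \sum_k \sum_l e k * e l * dot (z k) (z l) ^+ 2)%:E)%E.
Proof.
move=> z2 zz2 z0 W; have i2 := Lfun2_one.
have W2 : W \in L2 by exact: Lfun2_sum.
pose g (i : bool + K) : T -> R :=
  match i with inl true => W | inl false => one | inr k => z k end.
pose h (i : bool + K) : T -> R :=
  match i with inl true => one | inl false => W
             | inr k => fun q => (- 2 * e k) * z k q end.
have g2 i : g i \in L2 by case: i => [[]|].
have h2 i : h i \in L2 by case: i => [[]|k] //; exact: Lfun2_scale.
have E p q : \sum_k e k * (z k p - z k q) ^+ 2 = \sum_i g i p * h i q.
  rewrite big_sumType/= big_bool/= /W mulr1 mul1r -!big_split/=.
  by apply: eq_bigr => k _; ring.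
under eq_integral => q _.
  under eq_integral => p _ do rewrite E.
  over.
rewrite (iterated_integral_sqr_sum g2 h2); congr EFin.
rewrite big_sumType/= big_bool/= !big_sumType/= !big_bool/=.
have s0 f : \sum_k dot f (z k) * dot one (h (inr k)) = 0.
  by apply: big1 => k _; rewrite /= (dotC one) dotZl// z0 !mulr0.
have s1 f : \sum_k dot one (z k) * dot f (h (inr k)) = 0.
  by apply: big1 => k _; rewrite (dotC one) z0 mul0r.
have hh k l : dot (h (inr k)) (h (inr l)) = 4 * (e k * e l) * dot (z k) (z l).
  rewrite /h dotZl//; last exact: Lfun2_scale.
  by rewrite dotC dotZl// (dotC (z l)); ring.
rewrite s0 s1.
have -> : \sum_i \sum_(j : bool + K) dot (z i) (g j) *
     dot (fun q => - 2 * e i * z i q) (h j) =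
   4 * \sum_k \sum_l e k * e l * dot (z k) (z l) ^+ 2.
  rewrite mulr_sumr; apply: eq_bigr => k _.
  rewrite big_sumType/= big_bool/= z0 (dotZl _ (z2 k) i2) (dotC _ W) z0.
  rewrite !mulr0 !mul0r !add0r mulr_sumr.
  by apply: eq_bigr => l _; rewrite -/(h (inr k)) -/(h (inr l)) hh; ring.
by rewrite dot_one (dotC one W); ring.
Qed.

End SquareIntegrable.

(** * Sums weighted by a substochastic matrix *)

Section Assignment.
Context {R : realFieldType}.

(** A feasible and tight solution of the dual of the assignment problem with
weights [a i * b j]. Writing [a i * b i] as a telescoping sum and splitting each
step as [b k * (a k - a k.+1) + a k.+1 * (b k - b k.+1)], the potential [u]
collects the first parts and [v] the second ones. Tightness on the diagonal is
immediate; lowering [i] below [j] raises [u i] by at least as much as [a i * b j],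
since [b] is nonincreasing, and symmetrically for lowering [j] below [i]. *)
Lemma assignment_dual (n : nat) (a b : nat -> R) :
  (forall i j, (i <= j)%N -> a j <= a i) -> (forall i j, (i <= j)%N -> b j <= b i) ->
  (forall i, 0 <= a i) -> b n = 0 ->
  exists u v : nat -> R, [/\ forall i, 0 <= u i, forall j, 0 <= v j,
    forall i j, (j <= n)%N -> a i * b j <= u i + v j,
    forall k, (k <= n)%N -> u k + v k = a k * b k &
    forall i, (n <= i)%N -> u i = 0].
Proof.
move=> na nb a0 bn.
pose u i := \sum_(i <= k < n) b k * (a k - a k.+1).
pose v j := \sum_(j <= k < n) a k.+1 * (b k - b k.+1).
have uS i : (i < n)%N -> u i = b i * (a i - a i.+1) + u i.+1.
  by move=> h; rewrite /u big_ltn.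
have vS i : (i < n)%N -> v i = a i.+1 * (b i - b i.+1) + v i.+1.
  by move=> h; rewrite /v big_ltn.
have un i : (n <= i)%N -> u i = 0 by move=> h; rewrite /u big_geq.
have vn : v n = 0 by rewrite /v big_geq.
have uv d k : (k + d = n)%N -> u k + v k = a k * b k.
  elim: d k => [k|d IH k kd].
    by rewrite addn0 => ->; rewrite un// vn bn; ring.
  have kn : (k < n)%N by rewrite -kd addnS ltnS leq_addr.
  by have := IH k.+1; rewrite addSnnS => /(_ kd); rewrite (uS k)// (vS k)//; lra.
have uvn k : (k <= n)%N -> u k + v k = a k * b k.
  by move=> kn; apply: (uv (n - k)%N); rewrite subnKC.
have h1 d i : (i + d <= n)%N -> a i * b (i + d)%N <= u i + v (i + d)%N.
  elim: d i => [i|d IH i id]; first by rewrite addn0 => /uvn ->.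
  have lti : (i < n)%N by apply: leq_trans id; rewrite addnS ltnS leq_addr.
  have := IH i.+1; rewrite addSnnS => /(_ id); rewrite (uS i)//.
  have := nb i (i + d.+1)%N (leq_addr _ _); have := na i i.+1 (leqnSn i).
  nra.
have h2 d j : (j + d <= n)%N -> a (j + d)%N * b j <= u (j + d)%N + v j.
  elim: d j => [j|d IH j jd]; first by rewrite addn0 => /uvn ->.
  have ltj : (j < n)%N by apply: leq_trans jd; rewrite addnS ltnS leq_addr.
  have := IH j.+1; rewrite addSnnS => /(_ jd); rewrite (vS j)//.
  have : a (j + d.+1)%N <= a j.+1 by apply: na; rewrite addnS ltnS leq_addr.
  have := nb j j.+1 (leqnSn j).
  nra.
have h2' i j : (j <= i <= n)%N -> a i * b j <= u i + v j.
  by move=> /andP[ji ni]; rewrite -(subnKC ji); apply: h2; rewrite subnKC.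
have b0 k : (k <= n)%N -> 0 <= b k by move=> kn; rewrite -bn; exact: nb.
exists u, v; split => //.
- move=> i; rewrite /u big_nat_cond sumr_ge0// => k /andP[/andP[_ kn] _].
  by rewrite mulr_ge0 ?b0 ?(ltnW kn)// subr_ge0 na.
- move=> j; rewrite /v sumr_ge0// => k _.
  by rewrite mulr_ge0 ?a0// subr_ge0 nb.
- move=> i j jn; have [ij|ji] := leqP i j.
    by rewrite -(subnKC ij); apply: h1; rewrite subnKC.
  have [ni|ni] := leqP i n; first by apply: h2'; rewrite (ltnW ji).
  rewrite (un i (ltnW ni)) -(un n (leqnn n)).
  apply: le_trans (h2' n j _); last by rewrite jn leqnn.
  by rewrite ler_wpM2r ?b0// na// ltnW.
Qed.

(** Extending by zeros keeps a nonnegative sequence nonincreasing, and makes [b]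
vanish at [n], where the telescoping sums of [assignment_dual] stop. *)
Definition ext0 (n : nat) (a : 'I_n -> R) (k : nat) : R := oapp a 0 (insub k).

Lemma ext0_ord n (a : 'I_n -> R) (i : 'I_n) : ext0 a i = a i.
Proof. by rewrite /ext0 valK. Qed.

Lemma ext0_ge0 n (a : 'I_n -> R) k : (forall i, 0 <= a i) -> 0 <= ext0 a k.
Proof. by move=> a0; rewrite /ext0; case: insub => [i|] /=. Qed.

Lemma ext0_nonincreasing n (a : 'I_n -> R) : (forall i, 0 <= a i) ->
  (forall i j : 'I_n, (i <= j)%N -> a j <= a i) ->
  forall k l, (k <= l)%N -> ext0 a l <= ext0 a k.
Proof.
move=> a0 na k l kl; have [ln|ln] := ltnP l n; last first.
  by rewrite {1}/ext0 insubF ?ltnNge ?ln//=; exact: ext0_ge0.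
by rewrite (ext0_ord a (Ordinal ln)) (ext0_ord a (Ordinal (leq_ltn_trans kl ln))) na.
Qed.

(** Weak duality: [a i * b j <= u i + v j] is summed against [s], and the row and
column sums of [s] are at most 1. *)
Lemma sum_substochastic_le (m n : nat) (nm : (n <= m)%N)
    (a : 'I_m -> R) (b : 'I_n -> R) (s : 'I_m -> 'I_n -> R) :
  (forall i, 0 <= a i) -> (forall i j : 'I_m, (i <= j)%N -> a j <= a i) ->
  (forall i, 0 <= b i) -> (forall i j : 'I_n, (i <= j)%N -> b j <= b i) ->
  (forall i j, 0 <= s i j) ->
  (forall i, \sum_j s i j <= 1) -> (forall j, \sum_i s i j <= 1) ->
  \sum_i \sum_j a i * b j * s i j <= \sum_j a (widen_ord nm j) * b j.
Proof.
move=> a0 na b0 nb s0 s1 s2.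
have bn : ext0 b n = 0 by rewrite /ext0 insubF// ltnn.
have [u [v [u0 v0 uv uvE un]]] :=
  assignment_dual (ext0_nonincreasing a0 na) (ext0_nonincreasing b0 nb)
    (fun k => ext0_ge0 k a0) bn.
apply: (@le_trans _ _ (\sum_(i < m) \sum_(j < n) (u i + v j) * s i j)).
  apply: ler_sum => i _; apply: ler_sum => j _; rewrite ler_wpM2r//.
  by rewrite -(ext0_ord a) -(ext0_ord b); apply: uv; exact: ltnW.
have -> : \sum_(i < m) \sum_(j < n) (u i + v j) * s i j =
    \sum_(i < m) u i * (\sum_j s i j) + \sum_(j < n) v j * (\sum_i s i j).
  under [X in _ = _ + X]eq_bigr do rewrite mulr_sumr.
  rewrite [X in _ = _ + X]exchange_big -big_split; apply: eq_bigr => i _ /=.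
  by rewrite mulr_sumr -big_split; apply: eq_bigr => j _; rewrite /= mulrDl.
apply: (@le_trans _ _ (\sum_(i < m) u i + \sum_(j < n) v j)).
  by apply: lerD; apply: ler_sum => i _; rewrite ler_piMr.
have -> : \sum_(i < m) u i = \sum_(j < n) u j.
  rewrite -(big_mkord xpredT u) -(big_mkord xpredT u) (big_cat_nat _ nm)//=.
  rewrite [X in _ + X]big1_seq ?addr0// => i /=.
  by rewrite mem_index_iota => /andP[/un].
rewrite -big_split/=; apply: ler_sum => j _; rewrite (uvE _ (ltnW (ltn_ord j))).
by rewrite (ext0_ord b) -(ext0_ord a (widen_ord nm j)).
Qed.

(** The matrix [K i j ^+ 2 / (a i * b j)] is substochastic. If [b j = 0] the
division by zero is harmless: the column [K _ j] then vanishes by the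
first bound. *)
Lemma sum_sqr_cross_le (m n : nat) (nm : (n <= m)%N)
    (a : 'I_m -> R) (b : 'I_n -> R) (K : 'I_m -> 'I_n -> R) :
  (forall i, 0 < a i) -> (forall i j : 'I_m, (i <= j)%N -> a j <= a i) ->
  (forall i, 0 <= b i) -> (forall i j : 'I_n, (i <= j)%N -> b j <= b i) ->
  (forall j, \sum_i K i j ^+ 2 / a i <= b j) ->
  (forall i, \sum_j K i j ^+ 2 / b j <= a i) ->
  \sum_i \sum_j K i j ^+ 2 <= \sum_j a (widen_ord nm j) * b j.
Proof.
move=> a0 na b0 nb Ka Kb.
have K0 i j : b j = 0 -> K i j = 0.
  move=> bj; have := Ka j; rewrite bj => h.
  have h0 k : 0 <= K k j ^+ 2 / a k by rewrite divr_ge0 ?sqr_ge0 ?ltW.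
  have := le_trans _ h; rewrite (bigD1 i)//= => /(_ (K i j ^+ 2 / a i)).
  rewrite lerDl sumr_ge0// => /(_ isT).
  rewrite pmulr_lle0 ?invr_gt0// => h1; apply/eqP; rewrite -sqrf_eq0.
  by rewrite eq_le h1 sqr_ge0.
pose s i j := K i j ^+ 2 / a i / b j.
apply: le_trans (@sum_substochastic_le m n nm a b s _ na b0 nb _ _ _); last 4 first.
- by move=> i; exact: ltW.
- by move=> i j; rewrite divr_ge0// divr_ge0 ?sqr_ge0// ltW.
- move=> i; rewrite /s; under eq_bigr do rewrite mulrAC.
  by rewrite -mulr_suml ler_pdivrMr// mul1r; exact: Kb.
- move=> j; rewrite /s -mulr_suml; have [bj|bj] := eqVneq (b j) 0.
    by rewrite bj invr0 mulr0.
  rewrite ler_pdivrMr ?mul1r; first exact: Ka.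
  by rewrite lt_neqAle eq_sym bj b0.
apply: ler_sum => i _; apply: ler_sum => j _; rewrite /s.
have [bj|bj] := eqVneq (b j) 0; first by rewrite K0// expr0n !mul0r mulr0.
have -> : a i * b j * (K i j ^+ 2 / a i / b j) = K i j ^+ 2.
  by field; rewrite bj gt_eqF.
exact: lexx.
Qed.

End Assignment.

(** * Moments of the linear forms of a Gaussian vector *)

Section CenteredForms.
Context {R : realType}.

Lemma frobenius_sqr p q (A : 'M[R]_(p, q)) :
  frobenius A ^+ 2 = \sum_i \sum_j A i j ^+ 2.
Proof.
by rewrite sqr_sqrtr// sumr_ge0// => i _; rewrite sumr_ge0// => j _; exact: sqr_ge0.
Qed.

Context (T : Type) (n : nat) (X : T -> n.-tuple R) (a : 'cV[R]_n) (S : 'M[R]_n).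

Definition cform (u : 'cV[R]_n) (w : T) : R :=
  linform u (X w) - (u^T *m a) ord0 ord0.

Definition qform (u v : 'cV[R]_n) : R := (u^T *m S *m v) ord0 ord0.

(** The squared distance to the mean in the basis of the columns of [Q]; the
coefficients 1 give it the form of the sums in [dot_suml] and [dot_sumlr]. *)
Definition sqnorm (Q : 'M[R]_n) (w : T) : R := \sum_i 1 * cform (col i Q) w ^+ 2.

Lemma cformD u v w : cform (u + v) w = cform u w + cform v w.
Proof.
rewrite /cform /linform linearD/= mulmxDl mxE opprD addrACA -big_split/=.
by congr (_ + _); apply: eq_bigr => i _; rewrite mxE mulrDl.
Qed.

Lemma cformN u w : cform (- u) w = - cform u w.
Proof.
rewrite /cform /linform linearN/= mulNmx mxE opprD -sumrN; congr (_ + _).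
by apply: eq_bigr => i _; rewrite mxE mulNr.
Qed.

Lemma qformNN u : qform (- u) (- u) = qform u u.
Proof. by rewrite /qform [(- u)^T]linearN/= !mulNmx mulmxN opprK. Qed.

Lemma qformNr u v : qform u (- v) = - qform u v.
Proof. by rewrite /qform mulmxN mxE. Qed.

End CenteredForms.

Section GaussianVector.
Context d (T : measurableType d) (R : realType) (pi : probability T R).
Local Notation L2 := (Lfun pi 2%:E).
Local Notation one := (cst (1 : R) : T -> R).

Lemma integral_centered_gaussian_law (f : T -> R) (a v : R) (phi : R -> R) :
  measurable_fun setT f -> 0 <= v ->
  (forall A : set (measurableTypeR R), measurable A ->
    pi (f @^-1` A) = gaussian1 a v A) ->
  (forall x, 0 <= phi x) -> continuous phi ->
  (\int[pi]_w (phi (f w - a))%:E = ((Num.sqrt trigo.pi)^-1)%:E *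
    \int[lebesgue_measure]_z (phi (Num.sqrt (2 * v) * z) * gauss_fun z)%:E)%E.
Proof.
move=> mf v0 law phi0 cphi.
pose f' : T -> measurableTypeR R := f.
have mf' : measurable_fun setT f' := mf.
pose X : {mfun T >-> measurableTypeR R} := HB.pack f' (isMeasurableFun.Build _ _ _ _ f' mf').
have mphi : measurable_fun setT phi by exact: continuous_measurable_fun.
rewrite -(@integral_centered_gaussian1 _ (distribution pi X) a v phi v0 law phi0 cphi).
rewrite ge0_integral_distribution//=; last by move=> y; rewrite lee_fin.
apply/measurable_EFinP; apply: (measurableT_comp mphi).
exact: measurable_funB.
Qed.

Lemma integral_centered_gaussian_even_moment (f : T -> R) (a v : R) (k : nat) :
  measurable_fun setT f -> 0 <= v ->
  (forall A : set (measurableTypeR R), measurable A ->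
    pi (f @^-1` A) = gaussian1 a v A) ->
  (\int[pi]_w ((f w - a) ^+ (2 * k))%:E = (v ^+ k * \prod_(i < k) (2 * i).+1%:R)%:E)%E.
Proof.
move=> mf v0 law.
rewrite (@integral_centered_gaussian_law f a v (fun x => x ^+ (2 * k)))//; first last.
- exact: exprn_continuous.
- by move=> x; rewrite exprM exprn_ge0// sqr_ge0.
under eq_integral => z _.
  rewrite exprMn exprM sqr_sqrtr ?mulr_ge0// -mulrA EFinM.
  over.
have ge0 (z : R) : 0 <= z ^+ (2 * k) * gauss_fun z.
  by rewrite mulr_ge0 ?gauss_fun_ge0// exprM exprn_ge0// sqr_ge0.
rewrite ge0_integralZl//=; first last.
- by rewrite lee_fin exprn_ge0 ?mulr_ge0.
- by move=> x _; rewrite lee_fin.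
- apply/measurable_EFinP; apply: continuous_measurable_fun.
  exact: continuous_exprn_gauss_fun.
rewrite gauss_moment -!EFinM; congr EFin.
have sp : Num.sqrt trigo.pi != 0 :> R by rewrite gt_eqF// sqrtr_gt0 pi_gt0.
rewrite big_split/= prodr_const card_ord exprMn exprVn.
by field; rewrite sp expf_neq0.
Qed.

Context (n : nat) (X : T -> n.-tuple (measurableTypeR R)).
Context (a : 'cV[R]_n) (S : 'M[R]_n) (P : probability (n.-tuple (measurableTypeR R)) R).
Hypothesis mX : measurable_fun setT X.
Hypothesis lawX : forall A, measurable A -> pi (X @^-1` A) = P A.
Hypothesis gP : is_gaussian a S P.
Local Notation cform := (cform X a).
Local Notation qform := (qform S).

Lemma measurable_linform (u : 'cV[R]_n) :
  measurable_fun setT (linform u : n.-tuple (measurableTypeR R) -> measurableTypeR R).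
Proof.
apply: measurable_sum => i; apply: measurable_funM => //.
exact: measurable_tnth.
Qed.

Lemma measurable_linformX (u : 'cV[R]_n) :
  measurable_fun setT (fun w => linform u (X w) : R).
Proof. exact: (measurableT_comp (measurable_linform u) mX). Qed.

Lemma measurable_cform (u : 'cV[R]_n) : measurable_fun setT (cform u).
Proof. by apply: measurable_funB => //; exact: measurable_linformX. Qed.

Lemma qform_ge0 u : 0 <= qform u u.
Proof. exact: gP.1.2. Qed.

Lemma linform_law u (A : set (measurableTypeR R)) : measurable A ->
  pi ((fun w => linform u (X w)) @^-1` A) =
  gaussian1 ((u^T *m a) ord0 ord0) (qform u u) A.
Proof.
move=> mA; rewrite -gP.2// /pushforward -lawX//.
by rewrite -[X in measurable X]setTI; exact: measurable_linform.
Qed.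

Lemma cform_even_moment u k :
  (\int[pi]_w (cform u w ^+ (2 * k))%:E =
   (qform u u ^+ k * \prod_(i < k) (2 * i).+1%:R)%:E)%E.
Proof.
apply: integral_centered_gaussian_even_moment.
- exact: measurable_linformX.
- exact: qform_ge0.
- exact: linform_law.
Qed.

Lemma cform_exprn_Lfun2 u k : (fun w => cform u w ^+ k) \in L2.
Proof.
apply: Lfun2_sqr_integrable; first exact: measurable_funX (measurable_cform u).
apply/integrableP; split.
  apply/measurable_EFinP; apply: measurable_funX; apply: measurable_funX.
  exact: measurable_cform.
under eq_integral => w _.
  rewrite gee0_abs ?lee_fin ?sqr_ge0// -exprM mulnC.
  over.
by rewrite cform_even_moment ltry.
Qed.

Lemma cform_Lfun2 u : cform u \in L2.
Proof. exact: (cform_exprn_Lfun2 u 1). Qed.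

Lemma dot_cform u : dot pi (cform u) (cform u) = qform u u.
Proof.
have := cform_even_moment u 1; rewrite muln1 big_ord1 mulr1 expr1 => E.
by rewrite /dot /Rintegral -[RHS]/(fine (qform u u)%:E) -E; congr fine.
Qed.

Lemma dot_cform2 u : dot pi (fun w => cform u w ^+ 2) (fun w => cform u w ^+ 2) =
  3 * qform u u ^+ 2.
Proof.
have := cform_even_moment u 2; rewrite 2!big_ord_recl big_ord0 mul1r mulr1.
rewrite mulrC => E.
rewrite /dot /Rintegral -[RHS]/(fine (3 * qform u u ^+ 2)%:E) -E; congr fine.
by apply: eq_integral => w _; rewrite -exprD.
Qed.

Lemma qformC u v : qform u v = qform v u.
Proof.
rewrite /qform -[in LHS](trmxK (u^T *m S *m v)) mxE !trmx_mul trmxK.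
by rewrite (gP.1.1) mulmxA.
Qed.

Lemma qformDD u v : qform (u + v) (u + v) = qform u u + qform v v + 2 * qform u v.
Proof.
have E x y z t : qform (x + y) (z + t) = qform x z + qform x t + qform y z + qform y t.
  by rewrite /qform [(x + y)^T]linearD/= !mulmxDl !mulmxDr !mxE addrA.
by rewrite E (qformC v u); ring.
Qed.

(** The centred laws of the forms [u] and [- u] coincide, so [(y + 1) ^+ 2] has the
same integral for [y = cform u] and for [y = - cform u]; the difference of the two
integrals is four times the mean. *)
Lemma dot_cform_one u : dot pi (cform u) one = 0.
Proof.
have H f : f \in L2 -> dot pi (fun w => 1 * f w + 1 * one w) (fun w => 1 * f w + 1 * one w)
    = dot pi f f + 2 * dot pi f one + 1.
  by move=> f2; rewrite dot_lincomb2 ?Lfun2_one// dot_one; ring.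
have phi0 (x : R) : 0 <= (x + 1) ^+ 2 by exact: sqr_ge0.
have cphi : continuous (fun x : R => (x + 1) ^+ 2).
  move=> x; apply: (@continuous_comp _ _ _ (fun x : R => x + 1) (fun x => x ^+ 2)).
    by apply: cvgD; [exact: cvg_id|exact: cvg_cst].
  exact: exprn_continuous.
have D u' : qform u' u' = qform u u -> (\int[pi]_w ((cform u' w + 1) ^+ 2)%:E =
    \int[pi]_w ((cform u w + 1) ^+ 2)%:E)%E.
  move=> q; rewrite !(integral_centered_gaussian_law _ _ (linform_law _) phi0 cphi) ?q//;
    by [exact: measurable_linformX|exact: qform_ge0].
have E u' : dot pi (fun w => 1 * cform u' w + 1 * one w) (fun w => 1 * cform u' w + 1 * one w) =
    fine (\int[pi]_w ((cform u' w + 1) ^+ 2)%:E)%E.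
  by rewrite /dot /Rintegral; congr fine; apply: eq_integral => w _; rewrite !mul1r.
have := H _ (cform_Lfun2 (- u)); rewrite E D ?qformNN// -E H ?cform_Lfun2//.
have -> : dot pi (cform (- u)) one = - dot pi (cform u) one.
  rewrite -mulN1r -dotZl ?cform_Lfun2 ?Lfun2_one//.
  by congr dot; apply/funext => w; rewrite cformN mulN1r.
rewrite !dot_cform qformNN; lra.
Qed.

(** Polarization of the variances of [u + v], [u] and [v]. *)
Lemma dot_cformC u v : dot pi (cform u) (cform v) = qform u v.
Proof.
have : dot pi (cform (u + v)) (cform (u + v)) = 
   dot pi (fun w => 1 * cform u w + 1 * cform v w) (fun w => 1 * cform u w + 1 * cform v w).
  by congr dot; apply/funext => w; rewrite cformD !mul1r.
rewrite dot_lincomb2 ?cform_Lfun2// !dot_cform qformDD; lra.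
Qed.

(** Polarization of fourth moments:
[(x + y)^4 + (x - y)^4 = 2 x^4 + 2 y^4 + 12 x^2 y^2]. Here the fourth powers are
the squares of [(x^2 + y^2) + 2 x y] and [(x^2 + y^2) - 2 x y]. *)
Lemma dot_cform_sqr u v :
  dot pi (fun w => cform u w ^+ 2) (fun w => cform v w ^+ 2) =
  qform u u * qform v v + 2 * qform u v ^+ 2.
Proof.
pose A w := cform u w ^+ 2; pose B w := cform v w ^+ 2.
pose C w := cform u w * cform v w; pose D w := 1 * A w + 1 * B w.
have A2 : A \in L2 := cform_exprn_Lfun2 u 2.
have B2 : B \in L2 := cform_exprn_Lfun2 v 2.
have D2 : D \in L2 by apply: Lfun2_add; exact: Lfun2_scale.
have CE : C = (fun w => 4^-1 * cform (u + v) w ^+ 2 + (- 4^-1) * cform (u - v) w ^+ 2).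
  by apply/funext => w; rewrite !cformD cformN /C; field.
have C2 : C \in L2.
  by rewrite CE; apply: Lfun2_add; apply: Lfun2_scale; exact: cform_exprn_Lfun2.
have CC : dot pi C C = dot pi A B.
  by apply: eq_Rintegral => w _; rewrite /A /B /C; ring.
have := dot_cform2 (u + v).
have -> : (fun w => cform (u + v) w ^+ 2) = (fun w => 1 * D w + 2 * C w).
  by apply/funext => w; rewrite cformD /D /A /B /C; ring.
have := dot_cform2 (u - v).
have -> : (fun w => cform (u - v) w ^+ 2) = (fun w => 1 * D w + (- 2) * C w).
  by apply/funext => w; rewrite cformD cformN /D /A /B /C; ring.
rewrite !dot_lincomb2// CC !qformDD qformNN qformNr !dot_cform2.
rewrite -/A -/B; nra.
Qed.

Section Diagonalized.
Variables (Q D : 'M[R]_n).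
Hypothesis SQ : is_diagonalization S Q D.
Local Notation sqnorm := (sqnorm X a Q).

Lemma qform_col i j : qform (col i Q) (col j Q) = D i j.
Proof.
have [QQ _ _ SE] := SQ.
have -> : D = Q^T *m S *m Q.
  by rewrite SE !mulmxA QQ mul1mx -mulmxA QQ mulmx1.
rewrite /qform tr_col -row_mul mxE [RHS]mxE.
by apply: eq_bigr => k _; rewrite [row _ _ _ _]mxE [col _ _ _ _]mxE.
Qed.

Lemma eigenvalue_ge0 i : 0 <= D i i.
Proof. by rewrite -qform_col qform_ge0. Qed.

Lemma eigenvalue_gt0 i : S \in unitmx -> 0 < D i i.
Proof.
have [QQ dD _ SE] := SQ => uS.
rewrite lt_neqAle eigenvalue_ge0 andbT eq_sym; apply/eqP => Di0.
move: uS; rewrite SE !unitmx_mul => /andP[/andP[_ uD] _].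
move: uD; rewrite unitmxE det_trig; last exact: is_diag_mx_is_trig.
by rewrite (bigD1 i)//= Di0 mul0r unitr0.
Qed.

Lemma sqnorm_Lfun2 : sqnorm \in L2.
Proof. by apply: Lfun2_sum => i; exact: cform_exprn_Lfun2. Qed.

Lemma dot_sqnorm_one : dot pi sqnorm one = \tr D.
Proof.
rewrite dot_suml ?Lfun2_one//; last by move=> i; exact: cform_exprn_Lfun2.
apply: eq_bigr => i _; rewrite mul1r -qform_col -dot_cform.
by apply: eq_Rintegral => w _; rewrite /= mulr1.
Qed.

Lemma dot_sqnorm : dot pi sqnorm sqnorm = (\tr D) ^+ 2 + 2 * frobenius D ^+ 2.
Proof.
rewrite dot_sumlr; try by move=> i; exact: cform_exprn_Lfun2.
rewrite expr2 mulr_suml frobenius_sqr mulr_sumr -big_split/=.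
apply: eq_bigr => i _; rewrite !mulr_sumr -big_split/=.
by apply: eq_bigr => j _; rewrite dot_cform_sqr !qform_col !mul1r.
Qed.

(** [Q] is orthogonal, so the coordinates along its columns give the same
distance; the centring cancels in the differences. *)
Lemma edist_cform w w' :
  Defs.edist (X w) (X w') ^+ 2 = \sum_i (cform (col i Q) w - cform (col i Q) w') ^+ 2.
Proof.
have [QQ _ _ _] := SQ.
have QQT : Q *m Q^T = 1%:M by apply: mulmx1C.
rewrite sqr_sqrtr; last by rewrite sumr_ge0// => i _; exact: sqr_ge0.
pose x := \col_i (tnth (X w) i - tnth (X w') i) : 'cV[R]_n.
have nrm (y : 'cV[R]_n) : (y^T *m y) ord0 ord0 = \sum_i y i ord0 ^+ 2.
  by rewrite mxE; apply: eq_bigr => i _; rewrite mxE expr2.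
transitivity (\sum_i x i ord0 ^+ 2); first by apply: eq_bigr => i _; rewrite mxE.
rewrite -nrm -[X in X^T](mul1mx x) -QQT -mulmxA trmx_mul -mulmxA.
rewrite nrm; apply: eq_bigr => i _; congr (_ ^+ 2).
rewrite /cform opprB addrA subrK /linform -sumrB mxE.
by apply: eq_bigr => j _; rewrite !mxE mulrBr.
Qed.

End Diagonalized.

End GaussianVector.

(** * The lower bound for every coupling *)

(** Bessel's inequality for an orthogonal family with squared norms [a i]. If
[a i = 0] the corresponding term is 0, as [x / 0 = 0]. *)
Lemma bessel_sum {d} {T : measurableType d} {R : realType} (pi : probability T R)
    (I : finType) (x : I -> T -> R) (y : T -> R) (a : I -> R) :
  (forall i, x i \in Lfun pi 2%:E) -> y \in Lfun pi 2%:E ->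
  (forall i j, dot pi (x i) (x j) = if i == j then a i else 0) ->
  \sum_i dot pi (x i) y ^+ 2 / a i <= dot pi y y.
Proof.
move=> x2 y2 ortho.
pose c i := dot pi (x i) y / a i.
pose s w := \sum_i c i * x i w.
have s2 : s \in Lfun pi 2%:E by exact: Lfun2_sum.
have sy : dot pi s y = \sum_i dot pi (x i) y ^+ 2 / a i.
  by rewrite dot_suml//; apply: eq_bigr => i _; rewrite /c expr2; ring.
have ss : dot pi s s = \sum_i dot pi (x i) y ^+ 2 / a i.
  rewrite dot_sumlr//; apply: eq_bigr => i _; rewrite (bigD1 i)//= big1 => [|j ji].
    rewrite ortho eqxx addr0 /c; have [->|a0] := eqVneq (a i) 0.
      by rewrite invr0 !mulr0.
    by field.
  by rewrite ortho eq_sym (negbTE ji) mulr0.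
have := dot_ge0 pi (fun w => 1 * y w + (- 1) * s w).
rewrite dot_lincomb2// (dotC _ y) sy ss; lra.
Qed.

Section LowerBound.
Context {R : realType} (m n : nat) (nm : (n <= m)%N).
Variables (mu : probability (m.-tuple (measurableTypeR R)) R)
  (nu : probability (n.-tuple (measurableTypeR R)) R)
  (m0 : 'cV[R]_m) (S0 : 'M[R]_m) (m1 : 'cV[R]_n) (S1 : 'M[R]_n)
  (P0 D0 : 'M[R]_m) (P1 D1 : 'M[R]_n).
Hypotheses (hmu : is_gaussian m0 S0 mu) (hS0 : S0 \in unitmx)
  (hnu : is_gaussian m1 S1 nu)
  (hD0 : is_diagonalization S0 P0 D0) (hD1 : is_diagonalization S1 P1 D1).
Local Notation Rm := (m.-tuple (measurableTypeR R)).
Local Notation Rn := (n.-tuple (measurableTypeR R)).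
Variable pi : probability (Rm * Rn)%type R.
Hypothesis hpi : couplings mu nu pi.

Let law0 A : measurable A -> pi (fst @^-1` A) = mu A. Proof. exact: hpi.1. Qed.
Let law1 A : measurable A -> pi (snd @^-1` A) = nu A. Proof. exact: hpi.2. Qed.
Let mfst := @measurable_fst _ _ Rm Rn.
Let msnd := @measurable_snd _ _ Rm Rn.

Let x i : Rm * Rn -> R := cform fst m0 (col i P0).
Let y j : Rm * Rn -> R := cform snd m1 (col j P1).
Let K i j := dot pi (x i) (y j).

(** The expanded form in which [LGW2] meets the cost. As [D1] is diagonal, the only
cross terms of [leading_submx nm D0 - D1] are those of the diagonal. *)
Lemma LGW2E : LGW2 nm D0 D1 = 4 * (\tr D0 - \tr D1) ^+ 2
  + 8 * (frobenius D0 ^+ 2 + frobenius D1 ^+ 2 - frobenius D0 * frobenius D1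
         - \sum_j D0 (widen_ord nm j) (widen_ord nm j) * D1 j j).
Proof.
have [_ dD1 _ _] := hD1.
have E : frobenius (leading_submx nm D0 - D1) ^+ 2 =
    frobenius (leading_submx nm D0) ^+ 2 + frobenius D1 ^+ 2
    - 2 * \sum_j D0 (widen_ord nm j) (widen_ord nm j) * D1 j j.
  rewrite !frobenius_sqr -big_split mulr_sumr -sumrB/=; apply: eq_bigr => i _.
  have -> : D0 (widen_ord nm i) (widen_ord nm i) * D1 i i =
      \sum_j leading_submx nm D0 i j * D1 i j.
    rewrite (bigD1 i)//= big1 ?addr0 ?mxE// => j ji.
    by rewrite (is_diag_mxP dD1) ?mulr0// eq_sym.
  rewrite mulr_sumr -big_split -sumrB/=; apply: eq_bigr => j _.
  by rewrite !mxE; ring.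
by rewrite /LGW2 E; ring.
Qed.

Let x2 i : x i \in Lfun pi 2%:E. Proof. exact: (cform_Lfun2 mfst law0 hmu). Qed.
Let y2 j : y j \in Lfun pi 2%:E. Proof. exact: (cform_Lfun2 msnd law1 hnu). Qed.

Let xx i j : dot pi (x i) (x j) = D0 i j.
Proof. by rewrite (dot_cformC mfst law0 hmu) (qform_col hD0). Qed.

Let yy i j : dot pi (y i) (y j) = D1 i j.
Proof. by rewrite (dot_cformC msnd law1 hnu) (qform_col hD1). Qed.

Lemma sum_sqr_cross_covariance_le :
  \sum_i \sum_j K i j ^+ 2 <= \sum_j D0 (widen_ord nm j) (widen_ord nm j) * D1 j j.
Proof.
have [_ dD0 na _] := hD0; have [_ dD1 nb _] := hD1.
apply: (@sum_sqr_cross_le _ _ _ nm (fun i => D0 i i) (fun j => D1 j j)) => //.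
- by move=> i; exact: (eigenvalue_gt0 hmu hD0).
- by move=> j; exact: (eigenvalue_ge0 hnu hD1).
- move=> j; rewrite -yy; apply: bessel_sum => // i k; rewrite xx.
  by case: eqVneq => [->|ik] //; exact: (is_diag_mxP dD0).
- move=> i; rewrite -xx.
  apply: le_trans (bessel_sum (x := y) (a := fun j => D1 j j) y2 (x2 i) _).
    by apply: ler_sum => j _; rewrite /K dotC.
  by move=> j k; rewrite yy; case: eqVneq => [->|jk] //; exact: (is_diag_mxP dD1).
Qed.

(** [iterated_integral_quadratic] with the coordinates on R^m and R^n indexed by
['I_m + 'I_n], and sign [+1] on the former, [-1] on the latter. *)
Lemma GWcost_coordinates : GWcost pi =
  (2 * dot pi (fun p => sqnorm fst m0 P0 p - sqnorm snd m1 P1 p)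
     (fun p => sqnorm fst m0 P0 p - sqnorm snd m1 P1 p) +
   2 * (\tr D0 - \tr D1) ^+ 2 +
   4 * (frobenius D0 ^+ 2 + frobenius D1 ^+ 2 - 2 * \sum_i \sum_j K i j ^+ 2))%:E.
Proof.
pose e (k : 'I_m + 'I_n) : R := if k is inl _ then 1 else - 1.
pose z (k : 'I_m + 'I_n) := match k with inl i => x i | inr j => y j end.
have z2 k : z k \in Lfun pi 2%:E by case: k.
have zz2 k : (fun p => z k p ^+ 2) \in Lfun pi 2%:E.
  case: k => k; first exact: (cform_exprn_Lfun2 mfst law0 hmu).
  exact: (cform_exprn_Lfun2 msnd law1 hnu).
have z0 k : dot pi (z k) (cst 1) = 0.
  case: k => k; first exact: (dot_cform_one mfst law0 hmu).
  exact: (dot_cform_one msnd law1 hnu).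
have WE : (fun p => \sum_k e k * z k p ^+ 2) =
    (fun p => 1 * sqnorm fst m0 P0 p + (- 1) * sqnorm snd m1 P1 p).
  apply/funext => p; rewrite big_sumType/= mul1r; congr (_ + _).
  by rewrite mulr_sumr; apply: eq_bigr => j _; rewrite mul1r.
rewrite (_ : (fun p => sqnorm fst m0 P0 p - sqnorm snd m1 P1 p) =
    (fun p => \sum_k e k * z k p ^+ 2)); last first.
  by rewrite WE; apply/funext => p; rewrite mul1r mulN1r.
have s02 := sqnorm_Lfun2 mfst law0 hmu P0.
have s12 := sqnorm_Lfun2 msnd law1 hnu P1.
have tr : dot pi (fun p => \sum_k e k * z k p ^+ 2) (cst 1) = \tr D0 - \tr D1.
  have i2 := Lfun2_one pi.
  rewrite WE dotDl//; try exact: Lfun2_scale.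
  rewrite !dotZl// (dot_sqnorm_one mfst law0 hmu hD0).
  by rewrite (dot_sqnorm_one msnd law1 hnu hD1) mul1r mulN1r.
have C : \sum_k \sum_l e k * e l * dot pi (z k) (z l) ^+ 2 =
    frobenius D0 ^+ 2 + frobenius D1 ^+ 2 - 2 * \sum_i \sum_j K i j ^+ 2.
  rewrite big_sumType/=.
  under eq_bigr => i _.
    rewrite big_sumType/=.
    under eq_bigr do rewrite !mul1r xx.
    under [X in _ + X]eq_bigr do rewrite mul1r mulN1r -/(K i _).
    rewrite sumrN; over.
  under [X in _ + X]eq_bigr => j _.
    rewrite big_sumType/=.
    under eq_bigr do rewrite mulr1 mulN1r (dotC pi (y j)) -/(K _ j).
    under [X in _ + X]eq_bigr do rewrite mulrNN !mul1r yy.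
    rewrite sumrN; over.
  rewrite !big_split/= !sumrN !frobenius_sqr [X in _ + (- X + _)]exchange_big/=.
  ring.
rewrite /GWcost -tr -C -(iterated_integral_quadratic e z2 zz2 z0).
apply: eq_integral => q _; apply: eq_integral => p _; congr ((_ ^+ 2)%:E).
rewrite big_sumType/= (edist_cform fst m0 hD0) (edist_cform snd m1 hD1).
rewrite -sumrN; congr (_ + _); apply: eq_bigr => k _; first by rewrite mul1r.
by rewrite mulN1r.
Qed.

Lemma LGW2_le_GWcost : ((LGW2 nm D0 D1)%:E <= GWcost pi)%E.
Proof.
rewrite GWcost_coordinates LGW2E lee_fin.
have s02 := sqnorm_Lfun2 mfst law0 hmu P0.
have s12 := sqnorm_Lfun2 msnd law1 hnu P1.
have := covariance_dot_le s02 s12.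
rewrite (dot_sqnorm_one mfst law0 hmu hD0) (dot_sqnorm_one msnd law1 hnu hD1).
rewrite (_ : (fun p => sqnorm fst m0 P0 p - sqnorm snd m1 P1 p) =
    (fun p => 1 * sqnorm fst m0 P0 p + (- 1) * sqnorm snd m1 P1 p)); last first.
  by apply/funext => p; rewrite mul1r mulN1r.
rewrite dot_lincomb2//.
rewrite (dot_sqnorm mfst law0 hmu hD0) (dot_sqnorm msnd law1 hnu hD1).
have E (t f : R) : 0 <= f ->
    Num.sqrt (t ^+ 2 + 2 * f ^+ 2 - t ^+ 2) = Num.sqrt 2 * f.
  by move=> f0; rewrite addrC addKr (sqrtrM (f ^+ 2))// sqrtr_sqr ger0_norm.
rewrite !E ?sqrtr_ge0//.
have := sum_sqr_cross_covariance_le.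
have : Num.sqrt 2 * Num.sqrt 2 = 2 :> R by rewrite -expr2 sqr_sqrtr.
move: (\sum_i _) (\sum_j _) (Num.sqrt 2) => k l r rr kl.
have -> : r * frobenius D0 * (r * frobenius D1) = (r * r) * (frobenius D0 * frobenius D1) by ring.
rewrite rr; nra.
Qed.

End LowerBound.

Theorem proposition4p2 (R : realType) (m n : nat) (nm : (n <= m)%N)
    (mu : probability (m.-tuple (measurableTypeR R)) R)
    (nu : probability (n.-tuple (measurableTypeR R)) R)
    (m0 : 'cV[R]_m) (S0 : 'M[R]_m) (m1 : 'cV[R]_n) (S1 : 'M[R]_n)
    (P0 D0 : 'M[R]_m) (P1 D1 : 'M[R]_n)
    (hmu : is_gaussian m0 S0 mu) (hS0 : S0 \in unitmx)
    (hnu : is_gaussian m1 S1 nu)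
    (hD0 : is_diagonalization S0 P0 D0) (hD1 : is_diagonalization S1 P1 D1) :
  ((LGW2 nm D0 D1)%:E <= GW2 mu nu)%E /\ (GW2 mu nu <= GGW2 mu nu)%E.
Proof.
split.
  apply: le_ereal_inf_tmp => _ [pi hpi <-].
  exact: (LGW2_le_GWcost nm hmu hS0 hnu hD0 hD1 hpi).
by apply: ereal_inf_le_tmp => _ [pi [hpi _] <-]; exists pi.
Qed.
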